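(* Let $\mathfrak{g}$ be a finite-dimensional perfect complex Lie algebra (i.e. $[\mathfrak{g},\mathfrak{g}]=\mathfrak{g}$). Then every CPA-structure on $\mathfrak{g}$ is trivial, i.e. satisfies $x\cdot y=0$ for all $x,y\in\mathfrak{g}$.
   Context: A commutative post-Lie algebra structure (CPA-structure) on a Lie algebra $\mathfrak{g}$ with bracket $[\,,]$ on the vector space $V$ is a bilinear product $x\cdot y$ on $V$ satisfying, for all $x,y,z$: $x\cdot y=y\cdot x$; $[x,y]\cdot z=x\cdot(y\cdot z)-y\cdot(x\cdot z)$; $x\cdot[y,z]=[x\cdot y,z]+[y,x\cdot z]$. The trivial CPA-structure is $x\cdot y=0$ for all $x,y$. *)

(* Defs.v *)
(* The complex field is modelled as [R[i]] (mathcomp-real-closed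
   complex numbers) for an arbitrary [R : realType] (every realType is a
   complete archimedean ordered field, i.e. isomorphic to the reals). *)
From HB Require Import structures.
From mathcomp Require Import all_boot all_order all_algebra.
From mathcomp Require Import reals.
From mathcomp.real_closed Require Import complex.
Set Implicit Arguments. Unset Strict Implicit. Unset Printing Implicit Defensive.
Import Order.TTheory GRing.Theory Num.Theory.
Local Open Scope ring_scope.

Section Defs.
Variables (K : fieldType) (V : lmodType K).

Definition bilinear_op (op : V -> V -> V) : Prop :=
  (forall (a : K) (x y z : V), op (a *: x + y) z = a *: op x z + op y z) /\
  (forall (a : K) (x y z : V), op x (a *: y + z) = a *: op x y + op x z).

Definition is_lie_bracket (br : V -> V -> V) : Prop :=
  [/\ bilinear_op br,
      (forall x : V, br x x = 0) &
      (forall x y z : V, br x (br y z) + br y (br z x) + br z (br x y) = 0)].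

(* perfect: [g,g] = g, where [g,g] is the linear span of all brackets;
   by bilinearity every element of that span is a finite sum of brackets *)
Definition perfect_lie (br : V -> V -> V) : Prop :=
  forall x : V, exists (n : nat) (a b : 'I_n -> V),
    x = \sum_(i < n) br (a i) (b i).

Definition is_CPA (br : V -> V -> V) (dot : V -> V -> V) : Prop :=
  [/\ bilinear_op dot,
      (forall x y : V, dot x y = dot y x),
      (forall x y z : V, dot (br x y) z = dot x (dot y z) - dot y (dot x z)) &
      (forall x y z : V, dot x (br y z) = br (dot x y) z + br y (dot x z))].

End Defs.

(* Main.v *)
(* Write [L x] and [A x] for the multiplication by [x] and for [ad x]. The CPA
   axioms give [L (y.z) = L y o L z - L z o A y] as operators; taking traces,
   perfectness and commutativity force [tr (L x o L y) = 0] for all [x], [y].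
   As in Cartan's criterion, let [S] act on each generalized eigenspace of [L x]
   as the conjugate of the eigenvalue, and [T] similarly for [A x]: since [L x]
   acts on [L a] as [A x] acts on [a], one gets [S o L a - L a o S = L (T a)], so
   [tr (L x o S)], the sum of the squared moduli of the eigenvalues of [L x],
   vanishes and [L x] is nilpotent. If [ker L] were proper, Engel's theorem
   modulo [ker L] would give [w] outside [ker L] with [y.(x.w) = 0] for all [x],
   [y], hence [[x, y].w = 0], hence [L w = 0] by perfectness.

   Matrices act on row vectors on the right, so products of matrices below are
   compositions in the reverse order. *)
Require Import Defs.
From HB Require Import structures.
From mathcomp Require Import all_boot all_order all_algebra.
From mathcomp Require Import reals.
From mathcomp.real_closed Require Import complex.
Set Implicit Arguments. Unset Strict Implicit. Unset Printing Implicit Defensive.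
Import Order.TTheory GRing.Theory Num.Theory.
Local Open Scope ring_scope.

(** * Polynomials in a matrix and generalized eigenspaces *)

Section Spectral.
Variable C : fieldType.

Lemma coprimep_prod_XsubC_exp (s : seq C) a M k : a \notin s ->
  coprimep (('X - a%:P) ^+ k) (\prod_(d <- s) ('X - d%:P) ^+ M).
Proof.
move=> as_; apply: coprimep_expl; rewrite coprimep_sym coprimep_XsubC.
elim: s as_ => [|d s IH]; first by rewrite big_nil root1.
rewrite inE big_cons rootM !negb_or => /andP[ad /IH ->]; rewrite andbT.
case: (posnP M) => [->|M0]; first by rewrite expr0 root1.
by rewrite -(prednK M0) root_exp_XsubC.
Qed.

(** Chinese remainder theorem for the pairwise coprime moduli [('X - d%:P) ^+ M], by induction on
    [s]. *)
Lemma interpolate_mod_powers (f : C -> C) (s : seq C) M : uniq s ->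
  exists q : {poly C}, forall d, d \in s -> ('X - d%:P) ^+ M %| q - (f d)%:P.
Proof.
elim: s => [|a s IH] /=; first by exists 0.
case/andP=> as_ /IH[q Hq].
have /Bezout_eq1_coprimepP[[u v] /= uv] :=
  @coprimep_prod_XsubC_exp s a M M as_.
set P := \prod_(d <- s) _ in uv.
(* Modulo the power at [a], [v * P] is 1 and the new polynomial is [f a]; modulo the powers at
   points of [s], [P] is 0 and it is still [q]. *)
exists (q + v * P * ((f a)%:P - q)) => d; rewrite inE => /orP[/eqP ->|ds].
  have -> : q + v * P * ((f a)%:P - q) - (f a)%:P =
      u * ('X - a%:P) ^+ M * (q - (f a)%:P).
    have -> : u * ('X - a%:P) ^+ M = 1 - v * P by rewrite -uv addrK.
    by rewrite mulrBl mul1r -(opprB q (f a)%:P) mulrN addrAC.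
  by rewrite dvdp_mulr // dvdp_mull.
rewrite addrAC dvdp_add ?Hq // dvdp_mulr // dvdp_mull //.
by rewrite /P (big_rem d) //= dvdp_mulr.
Qed.

Variable n : nat.
Implicit Types (X T : 'M[C]_n.+1) (v : 'rV[C]_n.+1).

Lemma mulmx_hornerM X (p q : {poly C}) v :
  v *m horner_mx X p *m horner_mx X q = v *m horner_mx X (p * q).
Proof. by rewrite -mulmxA rmorphM. Qed.

Lemma coprimep_kermx X (p q : {poly C}) v : coprimep p q ->
  v *m horner_mx X p = 0 -> v *m horner_mx X q = 0 -> v = 0.
Proof.
move=> /Bezout_eq1_coprimepP[[u w] /= uw] vp vq.
rewrite -[v]mulmx1 -[1%:M](rmorph1 (horner_mx X)) -uw.
rewrite [u * p]mulrC [w * q]mulrC rmorphD !rmorphM /= mulmxDr.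
by rewrite !mulmxA vp vq !mul0mx addr0.
Qed.

Lemma horner_mx_XsubC_exp X a k :
  horner_mx X (('X - a%:P) ^+ k) = (X - a%:M) ^+ k.
Proof. by rewrite rmorphXn rmorphB /= horner_mx_X horner_mx_C. Qed.

(** Primary decomposition in the form of an induction principle: additive statements need only be
    checked on generalized eigenvectors. *)
Lemma gen_eigen_ind X (s : seq C) M (Q : 'rV[C]_n.+1 -> Prop) :
    uniq s -> (forall u v, Q u -> Q v -> Q (u + v)) ->
    (forall a k v, v *m (X - a%:M) ^+ k = 0 -> Q v) ->
  forall v, v *m horner_mx X (\prod_(d <- s) ('X - d%:P) ^+ M) = 0 -> Q v.
Proof.
move=> + QD Qe; elim: s => [|a s IH] /=.
  move=> _ v; rewrite big_nil rmorph1 mulmx1 => ->.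
  by apply: (Qe 0 0); rewrite mul0mx.
case/andP=> as_ us v; rewrite big_cons.
have /Bezout_eq1_coprimepP[[u w] /= uw] :=
  @coprimep_prod_XsubC_exp s a M M as_.
set P := \prod_(d <- s) _ in uw *; move: uw.
set p := _ ^+ M => uw vpP.
(* The Bezout identity splits [v] into a part killed by [P] and a part killed by [p]. *)
rewrite -[v]mulmx1 -[1%:M](rmorph1 (horner_mx X)) -uw rmorphD mulmxDr.
apply: QD.
  apply: IH => //; rewrite -/P mulmx_hornerM -mulrA mulrC.
  by rewrite -mulmx_hornerM vpP mul0mx.
apply: (Qe a M); rewrite -horner_mx_XsubC_exp -/p.
rewrite mulmx_hornerM (_ : w * P * p = p * P * w); last first.
  by rewrite -mulrA mulrC [P * p]mulrC.
by rewrite -mulmx_hornerM vpP mul0mx.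
Qed.

Lemma horner_mx_trig T (p : {poly C}) : is_trig_mx T ->
  is_trig_mx (horner_mx T p) /\ forall i, horner_mx T p i i = p.[T i i].
Proof.
move=> /is_trig_mxP Tt; elim/poly_ind: p => [|p c [/is_trig_mxP pt pd]].
  rewrite rmorph0; split; first exact: mx0_is_trig.
  by move=> i; rewrite mxE horner0.
rewrite rmorphD rmorphM /= horner_mx_X horner_mx_C; split.
  apply/is_trig_mxP => i j ij; rewrite !mxE big1 => [|k _].
    by rewrite -val_eqE ltn_eqF // mulr0n addr0.
  case: (ltnP i k) => [/pt ->|ki]; first by rewrite mul0r.
  by rewrite Tt ?mulr0 // (leq_ltn_trans ki).
move=> i; rewrite !mxE eqxx mulr1n hornerMXaddC -pd.
rewrite (bigD1 i) //= big1 ?addr0 // => k ki.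
move: ki; rewrite -val_eqE neq_ltn => /orP[ki|/pt ->]; last by rewrite mul0r.
by rewrite (Tt k) ?mulr0.
Qed.

End Spectral.

(** * The conjugate of the semisimple part of a complex matrix *)

Section Conj.
Variables (C : numClosedFieldType) (n : nat).
Implicit Types (X : 'M[C]_n.+1).

(** [S] is a polynomial in [X] taking the value [d^*] to high order at each eigenvalue [d]. After
    triangularization the trace of [S *m X] is the sum of the squared moduli of the eigenvalues, so
    its vanishing makes [X] nilpotent. *)
Lemma conj_semisimple_part X : exists S : 'M[C]_n.+1,
  [/\ forall a k (v : 'rV[C]_n.+1), v *m (X - a%:M) ^+ k = 0 -> v *m S = a^* *: v,
      forall Q : 'rV[C]_n.+1 -> Prop, (forall u v, Q u -> Q v -> Q (u + v)) ->
        (forall a k (v : 'rV[C]_n.+1), v *m (X - a%:M) ^+ k = 0 -> Q v) ->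
        forall v, Q v &
      \tr (S *m X) = 0 -> X ^+ n.+1 = 0].
Proof.
have [P Pu] := Schur X (ltn0Sn n); set T := conjmx P X => Ttrig.
have {}Pu : P \in unitmx by apply: unitarymx_unit.
have XE : X = invmx P *m T *m P by rewrite -conjVmx // /T conjmxK.
pose s := undup [seq T i i | i <- enum 'I_n.+1].
have charX : char_poly T = \prod_(i < n.+1) ('X - (T i i)%:P).
  exact: char_poly_trig.
pose p := \prod_(d <- s) ('X - d%:P) ^+ n.+1.
have hX q : horner_mx X q = invmx P *m horner_mx T q *m P.
  by rewrite XE horner_mx_uconjC.
have sT i : T i i \in s.
  by rewrite mem_undup; apply/mapP; exists i; rewrite ?mem_enum.
(* The exponent [n.+1] is the degree of the characteristic polynomial, which therefore divides [p]
   factor by factor. *)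
have pX : horner_mx X p = 0.
  rewrite hX; have /dvdpP[r ->] : char_poly T %| p.
    rewrite charX /p prodrXl -[in _ ^+ _](card_ord n.+1) -prodr_const.
    apply: (big_ind2 (fun a b : {poly C} => a %| b)) => [|a b c d|i _].
    - exact: dvdpp.
    - exact: dvdp_mul.
    - by rewrite (big_rem (T i i)) //= dvdp_mulIl.
  by rewrite rmorphM /= Cayley_Hamilton mulr0 mulmx0 mul0mx.
have [q Hq] := @interpolate_mod_powers C Num.conj s n.+1 (undup_uniq _).
exists (horner_mx X q); split.
- move=> a k v; rewrite -horner_mx_XsubC_exp => va.
  have vp : v *m horner_mx X p = 0 by rewrite pX mulmx0.
  have [as_|as_] := boolP (a \in s); last first.
    rewrite (coprimep_kermx (coprimep_prod_XsubC_exp _ _ as_) va vp).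
    by rewrite mul0mx scaler0.
  move: vp; rewrite /p (big_rem a) //= -mulmx_hornerM => vp.
  (* The given exponent [k] is arbitrary, while [q] is controlled only to order [n.+1]; coprimality
     with the other factors of [p] lowers it. *)
  have va' : v *m horner_mx X (('X - a%:P) ^+ n.+1) = 0.
    apply: (@coprimep_kermx _ _ X (('X - a%:P) ^+ k) _ _ _ _ vp).
      by apply: coprimep_prod_XsubC_exp; rewrite mem_rem_uniqF ?undup_uniq.
    by rewrite mulmx_hornerM mulrC -mulmx_hornerM va mul0mx.
  have /dvdpP[r qr] := Hq a as_.
  apply/eqP; rewrite -subr_eq0 -mul_mx_scalar -mulmxBr -(horner_mx_C X) -rmorphB.
  by rewrite qr mulrC rmorphM /= mulmxA va' mul0mx.
- move=> Q QD Qe v; apply: (@gen_eigen_ind _ _ X s n.+1 Q (undup_uniq _) QD Qe).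
  by rewrite -/p pX mulmx0.
- have -> : horner_mx X q *m X = horner_mx X (q * 'X).
    by rewrite rmorphM /= horner_mx_X.
  rewrite hX mxtrace_mulC mulmxA mulmxV // mul1mx.
  have [_ dT] := horner_mx_trig (q * 'X) Ttrig.
  rewrite /mxtrace (eq_bigr (fun i => `|T i i| ^+ 2)); last first.
    move=> i _; rewrite dT hornerM hornerX normCKC; congr (_ * _).
    have /dvdpP[r] := Hq _ (sT i).
    move/(congr1 (horner^~ (T i i))); rewrite !hornerE subrr expr0n mulr0.
    by move/eqP; rewrite subr_eq0 => /eqP.
  move=> /psumr_eq0P H.
  have T0 i : T i i = 0.
    apply/eqP; rewrite -normr_eq0 -sqrf_eq0; apply/eqP; apply: H => // *.
    exact: exprn_ge0.
  have : horner_mx T (char_poly T) = 0 by apply: Cayley_Hamilton.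
  rewrite charX (eq_bigr (fun => 'X)) => [|i _]; last by rewrite T0 subr0.
  rewrite prodr_const card_ord => Tn.
  have -> : X ^+ n.+1 = horner_mx X 'X^(n.+1) by rewrite rmorphXn /= horner_mx_X.
  by rewrite hX Tn mulmx0 mul0mx.
Qed.

End Conj.

(** * The commutator and the adjoint action on endomorphisms *)

Section Ad.
Variables (F : fieldType) (W : vectType F).
Implicit Types f g : 'End(W).

Definition end_comm f g : 'End(W) := (f \o g)%VF - (g \o f)%VF.

Lemma end_comm_is_linear f : linear (end_comm f).
Proof.
move=> a g h; rewrite /end_comm comp_lfunDr comp_lfunDl -comp_lfunZr -comp_lfunZl.
by rewrite scalerBr opprD addrACA.
Qed.
HB.instance Definition _ f :=
  GRing.isLinear.Build F 'End(W) 'End(W) *:%R (end_comm f) (end_comm_is_linear f).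

Lemma end_commC f g : end_comm f g = - end_comm g f.
Proof. by rewrite /end_comm opprB. Qed.

Definition end_ad f : 'End('End(W)) := linfun (end_comm f).

Lemma end_adE f g : end_ad f g = end_comm f g.
Proof. exact: lfunE. Qed.

Lemma end_ad_is_linear : linear end_ad.
Proof.
move=> a f g; apply/lfunP => h; rewrite add_lfunE scale_lfunE !end_adE /end_comm.
rewrite comp_lfunDr comp_lfunDl -comp_lfunZr -comp_lfunZl.
by rewrite scalerBr opprD addrACA.
Qed.
HB.instance Definition _ :=
  GRing.isLinear.Build F 'End(W) 'End('End(W)) *:%R end_ad end_ad_is_linear.

Lemma iter_lfun0 f k : iter k f 0 = 0.
Proof. by elim: k => //= k ->; rewrite linear0. Qed.

Lemma iter_lfunD f k u v : iter k f (u + v) = iter k f u + iter k f v.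
Proof. by elim: k => //= k ->; rewrite linearD. Qed.

Lemma iter_lfunN f k u : iter k f (- u) = - iter k f u.
Proof. by elim: k => //= k ->; rewrite linearN. Qed.

End Ad.

Lemma end_comm_ad (F : fieldType) (W : vectType F) (f g : 'End(W)) :
  end_comm (end_ad f) (end_ad g) = end_ad (end_comm f g).
Proof.
apply/lfunP => h; rewrite /end_comm add_lfunE opp_lfunE !comp_lfunE !end_adE.
rewrite /end_comm.
rewrite !(comp_lfunDl, comp_lfunDr, comp_lfunNl, comp_lfunNr) !comp_lfunA.
rewrite !opprD !opprK.
by rewrite [LHS](AC ((2*2)*(2*2)) (((1*5)*(8*4))*((2*7)*(3*6)))) /= !addNr !addr0.
Qed.

Definition nilpotent_end (F : fieldType) (W : vectType F) (f : 'End(W)) :=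
  exists k, forall v, iter k f v = 0.

Lemma nilpotent_end_ad (F : fieldType) (W : vectType F) (f : 'End(W)) :
  nilpotent_end f -> nilpotent_end (end_ad f).
Proof.
case=> k fk; exists (k + k)%N => h.
(* Expanding a power of [end_ad f] gives terms f^a g f^b up to sign; once [a + b] reaches [k + k],
   one of the outer powers vanishes. The sign is absorbed into [g]. *)
suff H N a b (g g' : 'End(W)) : (k + k <= a + b + N)%N ->
    (forall v, g' v = iter a f (g (iter b f v))) ->
    iter N (end_ad f) g' = 0.
  by apply: (H _ 0%N 0%N h).
elim: N a b g g' => [|N IH] a b g g' ab g'E.
  apply/lfunP => v; rewrite lfunE /= g'E.
  have [ka|ak] := leqP k a.
    by rewrite -(subnKC ka) iterD fk.
  have kb : (k <= b)%N.
    rewrite -(leq_add2l k) (leq_trans ab) // addn0 leq_add2r; exact: ltnW.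
  by rewrite -(subnKC kb) iterD fk linear0 iter_lfun0.
rewrite iterSr end_adE /end_comm -[RHS]addr0 iter_lfunD; congr (_ + _).
  apply: (IH a.+1 b g); first by rewrite !addSn -addnS.
  by move=> v; rewrite comp_lfunE g'E.
apply: (IH a b.+1 (- g)); first by rewrite addnS addSn -addnS.
by move=> v; rewrite !opp_lfunE comp_lfunE g'E -iterSr iter_lfunN.
Qed.

(** * Engel's theorem relative to a pair of invariant subspaces *)

Section Engel.
Variable F : fieldType.

Lemma dim_addv_line (E : vectType F) (m : {vspace E}) (y : E) :
  y \notin m -> \dim (m + <[y]>) = (\dim m).+1.
Proof.
move=> ym; apply/eqP; rewrite eqn_leq; apply/andP; split.
  rewrite (leq_trans (dimv_add_leqif _ _)) // -addn1 leq_add2l dim_vline.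
  by case: (_ != _).
rewrite ltn_neqAle dimvS ?addvSl // andbT.
by rewrite (dimv_leqif_sup (addvSl m <[y]>)) subv_add subvv -memvE.
Qed.

Lemma end_comm_addv_line (W : vectType F) (m : {vspace 'End(W)}) (y : 'End(W)) :
    {in m &, forall f g, end_comm f g \in m} ->
    {in m, forall f, end_comm f y \in m} ->
  {in (m + <[y]>)%VS &, forall f g, end_comm f g \in (m + <[y]>)%VS}.
Proof.
move=> mlie my f' g' /memv_addP[f fm [_ /vlineP[a ->] ->]]
  /memv_addP[g gm [_ /vlineP[b ->] ->]].
apply: (subvP (addvSl _ _)).
have mC u v : end_comm u v \in m -> end_comm v u \in m by rewrite end_commC memvN.
rewrite linearD linearZ /= memvD ?memvZ //; apply: (mC); rewrite linearD linearZ /=.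
  by rewrite memvD ?memvZ //; [apply: mlie | apply: my].
by rewrite memvD ?memvZ //; [apply/mC/my | rewrite /end_comm subrr mem0v].
Qed.

(** The subspaces [A] and [B] replace a quotient module. Since [W] varies in the induction on the
    dimension of [H], the statement also applies to the adjoint action of a subalgebra [m] on [H]
    modulo [m]. *)
Lemma engel (W : vectType F) (H : {vspace 'End(W)}) (A B : {vspace W}) :
    {in H &, forall f g, end_comm f g \in H} ->
    {in H, forall f, nilpotent_end f} ->
    (forall f v, f \in H -> v \in A -> f v \in A) ->
    (forall f v, f \in H -> v \in B -> f v \in B) ->
    ~~ (B <= A)%VS ->
  exists v, [/\ v \in B, v \notin A & forall f, f \in H -> f v \in A].
Proof.
have [d] := ubnP (\dim H); elim: d W H A B => // d IH W H A B dH Hlie Hnil HA HB BA.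
have [H0|Hn0] := eqVneq (\dim H) 0%N.
  have [v vB vA] := subvPn BA; exists v; split => // f.
  move/eqP: H0; rewrite dimv_eq0 => /eqP ->; rewrite memv0 => /eqP ->.
  by rewrite lfunE /= mem0v.
(* A proper subalgebra is properly contained in its normalizer: induction hypothesis for [ad @: m],
   with [m] and [H] as the invariant subspaces. *)
have step (m : {vspace 'End(W)}) : (m <= H)%VS -> (\dim m < \dim H)%N ->
    {in m &, forall f g, end_comm f g \in m} ->
    exists2 y, y \in H & y \notin m /\ {in m, forall f, end_comm f y \in m}.
  move=> mH dm mlie; pose ad := linfun (@end_ad F W).
  have adE f g : ad f g = end_comm f g by rewrite lfunE end_adE.
  have [||||||y [yH ym Hy]] := IH _ (ad @: m)%VS m H.
  - have := limg_ker_dim ad m; have := leq_trans dm (dH : _ <= d)%N.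
    by move=> md E; apply: leq_ltn_trans md; rewrite -E leq_addl.
  - move=> _ _ /memv_imgP[f fm ->] /memv_imgP[g gm ->].
    have -> : end_comm (ad f) (ad g) = ad (end_comm f g).
      by rewrite !lfunE /= end_comm_ad.
    by rewrite memv_img ?mlie.
  - move=> _ /memv_imgP[f fm ->]; rewrite lfunE; apply: nilpotent_end_ad.
    by apply: Hnil; apply: (subvP mH).
  - by move=> _ g /memv_imgP[f fm ->] gm; rewrite adE; apply: mlie.
  - move=> _ g /memv_imgP[f fm ->] gH; rewrite adE; apply: Hlie => //.
    exact: (subvP mH).
  - by apply: contraL dm => /dimvS; rewrite -leqNgt.
  exists y => //; split=> // f fm.
  by have := Hy _ (memv_img ad fm); rewrite adE.
(* Adjoining normalizing elements one at a time yields subalgebras of every smaller dimension, in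
   particular of codimension one. *)
have sub k : (k < \dim H)%N -> exists m : {vspace 'End(W)},
    [/\ (m <= H)%VS, \dim m = k & {in m &, forall f g, end_comm f g \in m}].
  elim: k => [_|k IHk kH].
    exists 0%VS; rewrite sub0v dimv0; split=> // f g.
    by rewrite !memv0 => /eqP -> _; rewrite /end_comm comp_lfun0l comp_lfun0r subrr.
  have [m [mH dm mlie]] := IHk (ltnW kH).
  have [|y yH [ym my]] := step m mH _ mlie; first by rewrite dm ltnW.
  exists (m + <[y]>)%VS; split.
  - by rewrite subv_add mH -memvE.
  - by rewrite dim_addv_line // dm.
  - exact: end_comm_addv_line.
have [m [mH dm mlie]] : exists m : {vspace 'End(W)},
    [/\ (m <= H)%VS, \dim m = (\dim H).-1 &
        {in m &, forall f g, end_comm f g \in m}].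
  by apply: sub; rewrite prednK ?lt0n.
have dmH : (\dim m < \dim H)%N by rewrite dm prednK ?lt0n.
have [y yH [ym my]] := step m mH dmH mlie.
have HE : H = (m + <[y]>)%VS.
  apply/eqP; rewrite eq_sym eqEdim subv_add mH -memvE yH /=.
  by rewrite dim_addv_line // dm prednK ?lt0n.
have [||||||v [vB vA mv]] := IH _ m A B.
- exact: leq_trans dmH _.
- exact: mlie.
- by move=> f fm; apply: Hnil; apply: (subvP mH).
- by move=> f u fm; apply: HA; apply: (subvP mH).
- by move=> f u fm; apply: HB; apply: (subvP mH).
- exact: BA.
(* The vectors of [B] sent into [A] by [m] are stable under [y], because f y = y f + [f, y] with
   [f, y] in [m]. *)
have yv k : iter k y v \in B /\ forall f, f \in m -> f (iter k y v) \in A.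
  elim: k => [|k [yB ym']] /=; first by split.
  split=> [|f fm]; first exact: HB.
  rewrite -[f _](addrK (y (f (iter k y v)))) addrAC memvD //.
    by have := ym' _ (my f fm); rewrite add_lfunE opp_lfunE !comp_lfunE.
  by apply: HA => //; apply: ym'.
have exA : exists k, iter k y v \in A.
  by have [j yj] := Hnil y yH; exists j; rewrite yj mem0v.
(* The last iterate of [v] under [y] before the first one in [A] is the required vector. *)
case: (ex_minnP exA) => [[|j] jA jmin]; first by rewrite jA in vA.
have [wB mw] := yv j; exists (iter j y v); split=> //.
  by apply: contraTN (ltnSn j) => /jmin; rewrite -leqNgt.
move=> f; rewrite HE => /memv_addP[g gm [_ /vlineP[a ->] ->]].
by rewrite add_lfunE scale_lfunE memvD ?mw ?memvZ.
Qed.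

End Engel.

(** The maps [dot x] and [br x] are bare functions whose linearity is a hypothesis, so the linear
    structure is packed on the spot. *)
Lemma mul_rV_lin1_mx (F : fieldType) m n (f : 'rV[F]_m -> 'rV[F]_n) v :
  linear f -> v *m lin1_mx f = f v.
Proof.
move=> lf; pose fM := GRing.isLinear.Build _ _ _ _ f lf.
pose g : {linear 'rV[F]_m -> 'rV[F]_n} := HB.pack f fM.
exact: (mul_rV_lin1 g).
Qed.

Lemma linfunE (F : fieldType) (U W : vectType F) (f : U -> W) v :
  linear f -> linfun f v = f v.
Proof.
move=> lf; pose fM := GRing.isLinear.Build _ _ _ _ f lf.
pose g : {linear U -> W} := HB.pack f fM.
exact: (lfunE g).
Qed.

Lemma perfect_lie_ind (K : fieldType) (V : lmodType K) (br : V -> V -> V)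
    (Q : V -> Prop) :
  perfect_lie br -> Q 0 -> (forall u v, Q u -> Q v -> Q (u + v)) ->
  (forall u v, Q (br u v)) -> forall x, Q x.
Proof.
by move=> perf Q0 QD Qbr x; have [m [a [b ->]]] := perf x; apply: big_ind.
Qed.

(** * CPA-structures on a space of row vectors *)

Section CPA.
Variables (C : numClosedFieldType) (n : nat).
Local Notation V := ('rV[C]_n.+1).
Variables (br dot : V -> V -> V).
Hypotheses (brP : is_lie_bracket br) (perf : perfect_lie br)
  (dotP : is_CPA br dot).

Let brR x : linear (br x).
Proof. by case: brP => -[_ H] _ _ a y z; apply: H. Qed.
Let dotL a x y z : dot (a *: x + y) z = a *: dot x z + dot y z.
Proof. by case: dotP => -[]. Qed.
Let dotR x : linear (dot x).
Proof. by case: dotP => -[_ H] _ _ _ a y z; apply: H. Qed.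
Let dotC x y : dot x y = dot y x.
Proof. by case: dotP. Qed.
Let dot_br x y z : dot (br x y) z = dot x (dot y z) - dot y (dot x z).
Proof. by case: dotP. Qed.
Let dot_der x y z : dot x (br y z) = br (dot x y) z + br y (dot x z).
Proof. by case: dotP. Qed.
Let dotDr x y z : dot x (y + z) = dot x y + dot x z.
Proof. by rewrite -[y]scale1r dotR !scale1r. Qed.
Let dotDl x y z : dot (y + z) x = dot y x + dot z x.
Proof. by rewrite !(dotC _ x) dotDr. Qed.
Let dot0r x : dot x 0 = 0.
Proof. by apply: (addrI (dot x 0)); rewrite -dotDr !addr0. Qed.
Let dotZr x a y : dot x (a *: y) = a *: dot x y.
Proof. by rewrite -[a *: y]addr0 dotR dot0r addr0. Qed.

Let L x : 'M[C]_n.+1 := lin1_mx (dot x).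
Let A x : 'M[C]_n.+1 := lin1_mx (br x).

Let LE x v : v *m L x = dot x v. Proof. exact: mul_rV_lin1_mx. Qed.
Let AE x v : v *m A x = br x v. Proof. exact: mul_rV_lin1_mx. Qed.

Let mx_ext (M N : 'M[C]_n.+1) : (forall v : V, v *m M = v *m N) -> M = N.
Proof. by move=> MN; apply/row_matrixP => i; rewrite !rowE. Qed.

Let L_add x y : L (x + y) = L x + L y.
Proof. by apply: mx_ext => v; rewrite mulmxDr !LE dotDl. Qed.

Let L_zero : L 0 = 0.
Proof. by apply: mx_ext => v; rewrite LE mulmx0 dotC dot0r. Qed.

Let L_br x y : L (br x y) = L y *m L x - L x *m L y.
Proof. by apply: mx_ext => v; rewrite mulmxBr !mulmxA !LE dot_br. Qed.

(** By commutativity, (y.z).v = v.(y.z), which is y.(v.z) - [y, v].z by the second axiom. *)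
Let L_dot y z : L (dot y z) = L z *m L y - A y *m L z.
Proof.
apply: mx_ext => v; rewrite mulmxBr !mulmxA !LE AE (dotC z (br y v)) dot_br.
by rewrite opprB (dotC v z) addrC subrK dotC.
Qed.

Let A_dot x y : A (dot x y) = A y *m L x - L x *m A y.
Proof. by apply: mx_ext => v; rewrite mulmxBr !mulmxA !LE !AE dot_der addrK. Qed.

Let trL x : \tr (L x) = 0.
Proof.
move: x; apply: perfect_lie_ind perf _ _ _ => [|u v Hu Hv|u v].
- by rewrite L_zero mxtrace0.
- by rewrite L_add mxtraceD Hu Hv addr0.
- by rewrite L_br linearB /= mxtrace_mulC subrr.
Qed.

Let trLL_A y z : \tr (L z *m L y) = \tr (A y *m L z).
Proof. by apply/eqP; rewrite -subr_eq0 -linearB /= -L_dot trL. Qed.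

(** [trLL_A] turns both sides into traces of products of [A x], [L y] and [L z], which agree by
    cyclicity. *)
Let trL_br_dot x y z : \tr (L y *m L (dot z x)) = \tr (L (br y z) *m L x).
Proof.
rewrite trLL_A A_dot trLL_A L_br mulmxBr mulmxBl !linearB /= !mulmxA.
by rewrite -[L z *m _ *m _]mulmxA [\tr (L z *m _)]mxtrace_mulC.
Qed.

(* [tr (L (br u y) *m L v)] is antisymmetric in [y] and [v], since the trace form
   is invariant, and symmetric, by [trL_br_dot] and the commutativity of [dot]. *)
Let trLL x y : \tr (L x *m L y) = 0.
Proof.
move: x; apply: perfect_lie_ind perf _ _ _ => [|u v Hu Hv|u v].
- by rewrite L_zero mul0mx mxtrace0.
- by rewrite L_add mulmxDl mxtraceD Hu Hv addr0.
have sym : \tr (L (br u v) *m L y) = \tr (L (br u y) *m L v).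
  by rewrite -!trL_br_dot dotC.
have anti : \tr (L (br u y) *m L v) = - \tr (L (br u v) *m L y).
  rewrite !L_br !mulmxBl !linearB /= opprB.
  rewrite -[L y *m _ *m _]mulmxA [\tr (L y *m _)]mxtrace_mulC.
  by rewrite [\tr (L u *m L y *m _)]mxtrace_mulC mulmxA.
apply/eqP; rewrite -[_ == 0](mulrn_eq0 _ 2) mulr2n.
by rewrite {2}sym anti subrr.
Qed.

(** Leibniz rule x.(u.v) = [x, u].v + u.(x.v): eigenvalues of [A x] and [L x] add up under the
    product. Each application of [L x - (a + b)%:M] lowers one of the two exponents. *)
Let dot_gen_eigen x i j a b u v :
  u *m (A x - a%:M) ^+ i = 0 -> v *m (L x - b%:M) ^+ j = 0 ->
  dot u v *m (L x - (a + b)%:M) ^+ (i + j) = 0.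
Proof.
have [N] := ubnP (i + j); elim: N i j u v => // N IH [|i] [|j] u v ijN ui vj.
- by rewrite -[u]mulmx1 ui dotC dot0r mul0mx.
- by rewrite -[u]mulmx1 ui dotC dot0r mul0mx.
- by rewrite -[v]mulmx1 vj dot0r mul0mx.
rewrite addSn exprS mulmxA.
have -> : dot u v *m (L x - (a + b)%:M) =
    dot u (v *m (L x - b%:M)) + dot (u *m (A x - a%:M)) v.
  rewrite !mulmxBr !mul_mx_scalar !LE AE scalerDl.
  rewrite -!scaleNr !dotDr !dotDl !dotZr (dotC (_ *: u)) dotZr dot_br (dotC v u).
  rewrite opprD -!scaleNr.
  by rewrite [RHS](AC (2*(2*1)) ((3*(5*2))*(1*4))) /= subrr addr0.
have uj : (i.+1 + j < N)%N by rewrite -addnS.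
have := ui; rewrite exprS mulmxA => ui'; have := vj; rewrite exprS mulmxA => vj'.
by rewrite mulmxDl {1}addnS -addSn !IH ?addr0.
Qed.

Let L_nilpotent x : L x ^+ n.+1 = 0.
Proof.
have [S [HS indS trS]] := conj_semisimple_part (L x).
have [T [HT indT _]] := conj_semisimple_part (A x).
apply: trS.
(* Both sides are additive in [a] and in the argument, so generalized eigenvectors suffice; there
   the conjugate eigenvalues subtract. *)
have comm a : L a *m S - S *m L a = L (a *m T).
  apply: mx_ext => v; rewrite mulmxBr !mulmxA !LE.
  move: v; apply: indS => [u v Hu Hv|b j v vj].
    by rewrite mulmxDl !dotDr mulmxDl -Hu -Hv opprD addrACA.
  rewrite (HS _ _ _ vj) dotZr.
  move: a; apply: indT => [u w Hu Hw|a i u ui].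
    by rewrite mulmxDl !dotDl mulmxDl -Hu -Hw scalerDr opprD addrACA.
  rewrite (HT _ _ _ ui) (HS _ _ _ (dot_gen_eigen ui vj)) rmorphD /= scalerDl.
  by rewrite addrK (dotC (_ *: u)) dotZr (dotC v).
have trS_L : forall y, \tr (S *m L y) = 0.
  apply: perfect_lie_ind perf _ _ _ => [|u v Hu Hv|u v].
  - by rewrite L_zero mulmx0 mxtrace0.
  - by rewrite L_add mulmxDr mxtraceD Hu Hv addr0.
  (* Cyclicity moves the commutator from the two [L] factors onto [S] and [L u], so that [comm] and
     [trLL] apply. *)
  rewrite L_br mulmxBr linearB /= mulmxA mxtrace_mulC !mulmxA.
  by rewrite -linearB /= -mulmxBl comm trLL.
exact: trS_L.
Qed.

Lemma rV_CPA_trivial x y : dot x y = 0.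
Proof.
pose f u : 'End(V) := linfun (dot u).
have fE u v : f u v = dot u v by apply: linfunE.
have flin : linear f.
  by move=> a u v; apply/lfunP => w; rewrite add_lfunE scale_lfunE !fE dotL.
pose ff := linfun f.
have ffE u v : ff u v = dot u v by rewrite linfunE.
have [/subvP sub|nsub] := boolP (fullv <= lker ff)%VS.
  by have := sub x (memvf x); rewrite memv_ker -ffE => /eqP ->; rewrite zero_lfunE.
(* The image of [ff] is closed under commutators by the second axiom, and by commutativity it
   annihilates the kernel of [ff]. *)
have [||g u||w [_ wK Hw]] := @engel _ _ (limg ff) (lker ff) fullv _ _ _ _ nsub.
- move=> _ _ /memv_imgP[u _ ->] /memv_imgP[v _ ->].
  have -> : end_comm (ff u) (ff v) = ff (br u v).
    apply/lfunP => w; rewrite /end_comm add_lfunE opp_lfunE !comp_lfunE !ffE.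
    by rewrite dot_br.
  by rewrite memv_img ?memvf.
- move=> _ /memv_imgP[u _ ->]; exists n.+1 => v.
  suff iterE k : iter k (ff u) v = v *m L u ^+ k.
    by rewrite iterE L_nilpotent mulmx0.
  elim: k => [|k IH]; first by rewrite expr0 mulmx1.
  by rewrite iterS IH ffE -LE -mulmxA exprSr.
- move=> /memv_imgP[v _ ->]; rewrite memv_ker => /eqP u0.
  by rewrite ffE dotC -ffE u0 zero_lfunE mem0v.
- by move=> *; apply: memvf.
case/negP: wK; rewrite memv_ker; apply/eqP/lfunP => u; rewrite zero_lfunE ffE dotC.
have dd u' v' : dot u' (dot v' w) = 0.
  have := Hw (ff v') (memv_img _ (memvf _)); rewrite memv_ker ffE => /eqP z.
  by rewrite dotC -ffE z zero_lfunE.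
move: u; apply: perfect_lie_ind perf _ _ _ => [|u v Hu Hv|u v].
- by rewrite dotC dot0r.
- by rewrite dotDl Hu Hv addr0.
- by rewrite dot_br !dd subrr.
Qed.

End CPA.

(** * Transfer to an arbitrary finite-dimensional space by coordinates *)

Lemma CPA_trivial (C : numClosedFieldType) (V : vectType C)
    (br : V -> V -> V) (dot : V -> V -> V) :
  is_lie_bracket br -> perfect_lie br -> is_CPA br dot ->
  forall x y : V, dot x y = 0.
Proof.
move=> [[brL brR] br0 brJ] perf [[dL dR] dC db dd] x y.
have eb := vbasisP {:V}.
have fK := passmx.rVofK eb; have gK := passmx.vecofK eb.
have fP := passmx.rVof_linear (vbasis {:V}).
have gP := passmx.vecof_linear (vbasis {:V}).
move: (passmx.rVof _) (passmx.vecof _) fP gP fK gK; move: (\dim _).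
(* Dimension zero is separate because the matrix arguments use the ring of square matrices of size
   [n.+1]. *)
case=> [|n] f' g' fP gP.
  by move=> fK _; rewrite -[dot x y]fK -[RHS]fK (thinmx0 (f' _)) (thinmx0 (f' 0)).
pose fM := GRing.isLinear.Build _ _ _ _ f' fP.
pose gM := GRing.isLinear.Build _ _ _ _ g' gP.
pose f : {linear V -> 'rV[C]_n.+1} := HB.pack f' fM.
pose g : {linear 'rV[C]_n.+1 -> V} := HB.pack g' gM.
rewrite -[f']/(f : _ -> _) -[g']/(g : _ -> _) => fK gK.
have flin a u v : f (a *: u + v) = a *: f u + f v := fP a u v.
have glin a u v : g (a *: u + v) = a *: g u + g v := gP a u v.
pose br' u v := f (br (g u) (g v)); pose dot' u v := f (dot (g u) (g v)).
suff H : forall u v, dot' u v = 0.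
  by have := H (f x) (f y); rewrite /dot' !fK => /(congr1 g); rewrite fK linear0.
apply: (@rV_CPA_trivial C n br') => [||].
- split; last 2 first.
  + by move=> u; rewrite /br' br0 linear0.
  + by move=> u v w; rewrite /br' !fK -!linearD brJ linear0.
  by split=> a u v w; rewrite /br' glin ?brL ?brR flin.
- move=> u; have [m [a [b E]]] := perf (g u).
  exists m, (f \o a), (f \o b); rewrite -[u]gK E linear_sum.
  by apply: eq_bigr => i _; rewrite /br' /comp !fK.
- split.
  + by split=> a u v w; rewrite /dot' glin ?dL ?dR flin.
  + by move=> u v; rewrite /dot' dC.
  + by move=> u v w; rewrite /dot' /br' !fK db linearB.
  + by move=> u v w; rewrite /dot' /br' !fK dd linearD.
Qed.

Local Open Scope complex_scope.

Theorem theorem3p3 (R : realType) (V : vectType R[i])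
    (br : V -> V -> V) (dot : V -> V -> V) :
  is_lie_bracket br -> perfect_lie br -> is_CPA br dot ->
  forall x y : V, dot x y = 0.
Proof.
exact: CPA_trivial.
Qed.
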